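(* Let $(X_n)$ be i.i.d. non-lattice real random variables distributed as $X$ with $\mathbb{P}(X<0)>0$, and let $(Y_n)$ be i.i.d., independent of $(X_n)$, with $\mathbb{P}(Y_1=1)=p=1-\mathbb{P}(Y_1=-1)$, $p\in[0,1)$. Assume $X\in\mathcal{S}(\gamma)$ for some $\gamma>0$ and $\varphi(\gamma)=\mathbb{E}[e^{\gamma X}]<1/p$. Let $W$ have the stationary distribution of $W_{n+1}=(Y_nW_n+X_n)^+$, i.e. $W\stackrel{D}{=}(YW+X)^+$ with $W,Y,X$ independent. Let $E_\gamma$ be exponential with parameter $\gamma$, with $X,W,E_\gamma$ independent. Then \[\mathbb{P}(W>x)\sim C_\gamma\,\mathbb{P}(X>x)\quad(x\to\infty),\] where \[C_\gamma=\frac{(1-p)p}{(1-p\varphi(\gamma))^2}\Big[\mathbb{P}(X-W+E_\gamma\le0)+\frac{p}{1-p}\mathbb{P}(X+W+E_\gamma\le0)\Big]+\frac{1-p}{(1-p\varphi(\gamma))^2}\mathbb{E}[e^{-\gamma W}].\]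
   Context: $X\in\mathcal{S}(\gamma)$ means: $\mathbb{P}(X>x+y)/\mathbb{P}(X>x)\to e^{-\gamma y}$ as $x\to\infty$ for each fixed $y$, and $\mathbb{P}(X_1+X_2>x)\sim 2\mathbb{E}[e^{\gamma X}]\mathbb{P}(X>x)$ for independent copies $X_1,X_2$. $f\sim g$ means $f(x)/g(x)\to1$. *)

(* Defs.v *)
From HB Require Import structures.
From mathcomp Require Import all_boot all_order all_algebra.
From mathcomp Require Import all_classical all_reals all_analysis.
Set Implicit Arguments. Unset Strict Implicit. Unset Printing Implicit Defensive.
Import Order.TTheory GRing.Theory Num.Theory.
Import numFieldNormedType.Exports.
Local Open Scope classical_set_scope.
Local Open Scope ring_scope.

Definition asym_equiv {R : realType} (f g : R -> R) : Prop :=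
  (f x / g x) @[x --> +oo] --> (1 : R).

Definition nonlattice {R : realType} (mu : set R -> \bar R) : Prop :=
  ~ (exists a h : R, 0 < h /\
       mu [set x | exists k : int, x = a + k%:~R * h] = 1%E).

Definition mgf {R : realType} (mu : probability R R) (g : R) : \bar R :=
  (\int[mu]_x (expR (g * x))%:E)%E.

Definition in_S {R : realType} (mu : probability R R) (gam : R) : Prop :=
  (mgf mu gam < +oo)%E /\
  (forall y : R,
     (fine (mu `]x + y, +oo[%classic) / fine (mu `]x, +oo[%classic))
       @[x --> +oo] --> expR (- gam * y)) /\
  asym_equiv (fun x => fine ((mu \x mu)%E [set z : R * R | x < z.1 + z.2]))
             (fun x => 2 * fine (mgf mu gam) * fine (mu `]x, +oo[%classic)).

Definition independent4 {R : realType} {d : measure_display}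
  {T : measurableType d} (P : probability T R) (X1 X2 X3 X4 : T -> R) : Prop :=
  forall A1 A2 A3 A4 : set R,
    measurable A1 -> measurable A2 -> measurable A3 -> measurable A4 ->
    P (X1 @^-1` A1 `&` X2 @^-1` A2 `&` X3 @^-1` A3 `&` X4 @^-1` A4) =
    (P (X1 @^-1` A1) * P (X2 @^-1` A2) * P (X3 @^-1` A3) * P (X4 @^-1` A4))%E.

(* Main.v *)
(* Write F and f for the tails of X and W, phi = E exp(gam X), and take x >= 0.
   Stationarity gives f(x) = p P(X + W > x) + (1 - p) P(X - W > x), and for every
   level A the event X + W > x splits according to whether X <= x - A:
     P(X + W > x) = E[f(x - X); X <= x - A] + E F(x - min(W, A)).
   By dominated convergence the last term and P(X - W > x), divided by F(x), tend
   to E exp(gam min(W, A)) and E exp(- gam W).  The same splitting of X1 + X2,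
   together with P(X1 + X2 > x) ~ 2 phi F(x), yields
     E[F(x - X); X <= x - A] / F(x) --> 2 phi - E exp(gam min(X, A)),
   which is close to phi for large A.  Hence a bound f <= a F on [A, +oo[ improves
   to f <= (p phi a + q + eps) F near +oo, with
   q = p E exp(gam W) + (1 - p) E exp(- gam W), and likewise from below; since
   p phi < 1, iterating gives f / F --> q / (1 - p phi).  A first finite a comes
   from the same inequality applied to bounds of the form a F + p ^ n, and a lower
   bound with a = 0 forces E exp(gam W) < +oo when p > 0.  Finally E exp(gam W) is
   computed from the stationary equation using
     exp(gam max(z, 0)) = exp(gam z) + P(z + E_gam <= 0). *)
Require Import Defs.
From HB Require Import structures.
From mathcomp Require Import all_boot all_order all_algebra.
From mathcomp Require Import all_classical all_reals all_analysis.
From mathcomp Require Import measurable_realfun ring lra.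
Import Order.TTheory GRing.Theory Num.Theory.
Import numFieldNormedType.Exports.
Local Open Scope classical_set_scope.
Local Open Scope ring_scope.
Set Implicit Arguments. Unset Strict Implicit. Unset Printing Implicit Defensive.

(** * Measurability of comparison sets and integrability of bounded functions *)

Lemma measurable_set_lt d (T : measurableType d) (R : realType) (f g : T -> R) :
  measurable_fun setT f -> measurable_fun setT g ->
  measurable [set t | f t < g t].
Proof.
move=> mf mg.
have := measurable_fun_ltr mf mg measurableT (Y := [set true]) I.
by by rewrite setTI.
Qed.

Lemma measurable_set_le d (T : measurableType d) (R : realType) (f g : T -> R) :
  measurable_fun setT f -> measurable_fun setT g ->
  measurable [set t | f t <= g t].
Proof.
move=> mf mg; rewrite (_ : [set _ | _] = ~` [set t | g t < f t]).
  by apply: measurableC; exact: measurable_set_lt.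
by apply/seteqP; split => t /=; rewrite real_leNgt ?num_real// => /negP.
Qed.

Lemma integrable_norm_le d (T : measurableType d) (R : realType)
    (m : probability T R) (g : T -> R) (M : R) :
  measurable_fun setT g -> (forall t, `|g t| <= M) ->
  m.-integrable setT (EFin \o g).
Proof.
move=> mg gM; apply: measurable_bounded_integrable => //.
  by rewrite (le_lt_trans (probability_le1 _ _)) ?ltry.
by exists M; split; rewrite ?num_real// => x Mx t _; apply/(le_trans (gM t))/ltW.
Qed.

(** * Tail functions of laws on the line *)

Section tail.
Variables (R : realType) (m : probability R R).

Definition tail (x : R) : R := fine (m `]x, +oo[%classic).

Lemma tailE x : m `]x, +oo[%classic = (tail x)%:E.
Proof. by rewrite /tail fineK// fin_num_measure. Qed.

Lemma tail_ge0 x : 0 <= tail x.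
Proof. by rewrite fine_ge0. Qed.

Lemma tail_le1 x : tail x <= 1.
Proof. by rewrite -lee_fin -tailE probability_le1. Qed.

Lemma tail_norm_le1 x : `|tail x| <= 1.
Proof. by rewrite ger0_norm ?tail_ge0 ?tail_le1. Qed.

Lemma tail_nonincr x y : x <= y -> tail y <= tail x.
Proof.
move=> xy; rewrite -lee_fin -!tailE le_measure ?inE//.
by apply: subset_itvr; rewrite bnd_simp.
Qed.

Lemma measurable_tail : measurable_fun setT tail.
Proof.
rewrite (_ : tail = (fun x => tail (- x)) \o -%R); last first.
  by apply/funext => x /=; rewrite opprK.
apply: measurableT_comp => //; apply: nondecreasing_measurable => // x y xy.
by rewrite tail_nonincr// lerN2.
Qed.

End tail.

(** * Tails of sums and differences of independent variables *)

Section tail_convolution.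
Variables (R : realType) (mu nu : probability R R).

(* E[P(W > x - X); X <= x - A], for X ~ mu and W ~ nu independent *)
Definition lower_conv (A x : R) : R :=
  \int[mu]_u (tail nu (x - u) * (u <= x - A)%R%:R).

Let m1 : measurable_fun [set: R * R] (fst : R * R -> R) := measurable_fst.
Let m2 : measurable_fun [set: R * R] (snd : R * R -> R) := measurable_snd.

Lemma measurable_lower_integrand (m : probability R R) (A x : R) :
  measurable_fun setT (fun u : R => tail m (x - u) * (u <= x - A)%R%:R).
Proof.
apply: measurable_funM.
  apply: measurableT_comp; first exact: measurable_tail.
  by apply: measurable_funB.
rewrite (_ : (fun _ => _) = \1_[set u : R | u <= x - A]); last first.
  by apply/funext => u; rewrite indicE; congr ((nat_of_bool _)%:R);
    apply/idP/idP; rewrite inE.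
by apply: measurable_indic; apply: measurable_set_le.
Qed.

Lemma integrable_lower_integrand (m : probability R R) (A x : R) :
  mu.-integrable setT (EFin \o (fun u : R => tail m (x - u) * (u <= x - A)%R%:R)).
Proof.
apply: (@integrable_norm_le _ _ _ _ _ 1).
  exact: measurable_lower_integrand.
move=> u; rewrite normrM -[leRHS]mulr1 ler_pM ?tail_norm_le1//.
by case: (u <= _); rewrite ?normr1 ?normr0 ?ler01.
Qed.

Lemma measurable_upper_integrand (k : R -> R) (x : R) : measurable_fun setT k ->
  measurable_fun setT (fun w => tail mu (x - k w)).
Proof.
move=> mk; apply: measurableT_comp; first exact: measurable_tail.
by apply: measurable_funB.
Qed.

Lemma integrable_upper_integrand (k : R -> R) (x : R) : measurable_fun setT k ->
  nu.-integrable setT (EFin \o (fun w => tail mu (x - k w))).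
Proof.
move=> mk; apply: (@integrable_norm_le _ _ _ _ _ 1).
  exact: measurable_upper_integrand.
by move=> u; exact: tail_norm_le1.
Qed.

(** The product measure integrates the sections at a fixed first coordinate. Integrating the other
    sections gives a measure with the same values on rectangles, hence the same measure. *)
Lemma prod_probability_snd (S : set (R * R)) : measurable S ->
  ((mu \x nu) S = \int[nu]_w mu (ysection S w))%E.
Proof.
move=> mS; rewrite -[RHS]/(product_measure2 mu nu S).
apply: product_measure_unique => // B C mB mC.
exact: product_measure2E.
Qed.

(** The conditions [x < u + w] and [x - A < u] together amount to [x - Num.min w A < u], so [S2] is
    exactly what [S1] leaves of the event. [S1] is cut at fixed [u], which produces [lower_conv];
    [S2] is cut at fixed [w], which leaves a shift of [tail mu] bounded above by [A]. *)
Lemma tail_add (A x : R) :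
  fine ((mu \x nu)%E [set z : R * R | x < z.1 + z.2]) =
  lower_conv A x + \int[nu]_w tail mu (x - Num.min w A).
Proof.
pose S1 := [set z : R * R | x < z.1 + z.2] `&` [set z : R * R | z.1 <= x - A].
pose S2 := [set z : R * R | x - Num.min z.2 A < z.1].
have mS1 : measurable S1.
  apply: measurableI; first by apply: measurable_set_lt => //; exact: measurable_funD.
  by apply: measurable_set_le.
have mS2 : measurable S2.
  apply: measurable_set_lt => //; apply: measurable_funB => //.
  exact: measurable_minr.
have -> : [set z : R * R | x < z.1 + z.2] = S1 `|` S2.
  rewrite /S1 /S2; apply/seteqP; split => -[u w] /=.
    by move=> h; have [?|?] := lerP u (x - A); [left|right];
      rewrite // ltrBlDr -ltrBlDl lt_min !ltrBlDl; apply/andP; split; lra.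
  by move=> [[]//|]; rewrite ltrBlDr -ltrBlDl lt_min => /andP[]; lra.
rewrite measureU//; last first.
  apply/seteqP; split => -[u w] //= [[_]].
  by move=> /= h; rewrite /S2/= ltrBlDr -ltrBlDl lt_min => /andP[]; lra.
rewrite [X in (X + _)%E](_ : _ = (lower_conv A x)%:E); last first.
  rewrite /product_measure1/= /lower_conv /Rintegral fineK; last first.
    by apply: integrable_fin_num => //; exact: integrable_lower_integrand.
  apply: eq_integral => u _ /=; rewrite /S1.
  have [uA|uA] := boolP (u <= x - A).
    rewrite mulr1 -tailE; congr (nu _); apply/seteqP; split => w /=;
      rewrite /xsection/= in_setE/= in_itv/= andbT.
      by case; lra.
    by move=> ?; split => //; lra.
  rewrite mulr0 (_ : xsection _ _ = set0) ?measure0//.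
  by apply/seteqP; split => w //=; rewrite /xsection/= in_setE/= => -[_]; exact/negP.
rewrite [X in (_ + X)%E](_ : _ = (\int[nu]_w tail mu (x - Num.min w A))%:E)//; last first.
  rewrite -[LHS]/((mu \x nu)%E S2).
  rewrite prod_probability_snd// /Rintegral fineK; last first.
    apply: integrable_fin_num => //; apply: integrable_upper_integrand.
    by apply: measurable_minr.
  apply: eq_integral => w _; rewrite -tailE; congr (mu _).
  by apply/seteqP; split => u /=; rewrite /ysection/= in_setE/= in_itv/= andbT.
Qed.

(** The double sign in [x - (- w)] fits the pattern [x - k w] of [tail_ratio_cvg], with
    [k w = - w]. *)
Lemma tail_sub (x : R) :
  fine ((mu \x nu)%E [set z : R * R | x < z.1 - z.2]) =
  \int[nu]_w tail mu (x - (- w)).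
Proof.
have mS : measurable [set z : R * R | x < z.1 - z.2].
  by apply: measurable_set_lt => //; exact: measurable_funB.
rewrite prod_probability_snd// /Rintegral; congr fine.
apply: eq_integral => w _; rewrite -tailE; congr (mu _).
by apply/seteqP; split => u /=; rewrite /ysection/= in_setE/= in_itv/= andbT; lra.
Qed.

End tail_convolution.

(** * Laws whose tail is asymptotically exponential under shifts *)

Section long_tail.
Variables (R : realType) (mu : probability R R) (gam : R).
Hypothesis mu_long : forall y : R,
  tail mu (x + y) / tail mu x @[x --> +oo] --> expR (- gam * y).

(** A zero of the tail would persist at all larger arguments. There the quotient is [0 / 0 = 0] by
    convention, while its limit for the shift 0 is positive. *)
Lemma long_tail_gt0 x : 0 < tail mu x.
Proof.
rewrite lt_neqAle tail_ge0 andbT eq_sym; apply/negP => /eqP tx0.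
move/cvgrPdist_lt : (@mu_long 0) => /(_ _ (expR_gt0 (- gam * 0))) h; near +oo_R => z.
have xz : x <= z by near: z; apply: nbhs_pinfty_ge; rewrite num_real.
have tz : tail mu z = 0.
  by apply/eqP; rewrite eq_le tail_ge0 andbT -tx0 tail_nonincr.
have : `|expR (- gam * 0) - tail mu (z + 0) / tail mu z| < expR (- gam * 0).
  by near: z.
by rewrite addr0 tz mul0r subr0 ger0_norm ?expR_ge0// ltxx.
Unshelve. all: by end_near. Qed.

(** Dominated convergence: the ratio converges for each fixed [w], and [k w <= A] bounds it by
    [tail mu (x - A) / tail mu x], which is itself convergent and so eventually bounded. Only an
    upper bound on [k] is needed, as the tail is nonincreasing. *)
Lemma tail_ratio_cvg (nu : probability R R) (k : R -> R) (A : R) :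
  measurable_fun setT k -> {ae nu, forall w, k w <= A} ->
  (\int[nu]_w tail mu (x - k w)) / tail mu x @[x --> +oo] -->
    \int[nu]_w expR (gam * k w).
Proof.
move=> mk kA; apply/cvg_pinftyP => u uoo.
have [M MP] : exists M, \forall n \near \oo, tail mu (u n - A) / tail mu (u n) <= M.
  exists (expR (- gam * (- A)) + 1).
  move/cvg_pinftyP : (@mu_long (- A)) => /(_ _ uoo)/cvgr_le.
  by apply; rewrite ltrDl.
case: MP => N _ NM.
(* The domination must hold at every index, so the sequence is started at [N], from where [NM]
   applies. *)
rewrite -(cvg_shiftn N).
pose f_ n w := (tail mu (u (n + N)%N - k w) / tail mu (u (n + N)%N))%:E.
have mf n : measurable_fun setT (f_ n).
  apply/measurable_EFinP; apply: measurable_funM => //.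
  exact: measurable_upper_integrand.
have fE n : (\int[nu]_w tail mu (u (n + N)%N - k w)) / tail mu (u (n + N)%N) =
    fine (\int[nu]_w f_ n w)%E.
  by rewrite -RintegralZr//; apply: integrable_upper_integrand.
rewrite [X in X @ _ --> _](_ : _ = fine \o (fun n => \int[nu]_w f_ n w)%E); last first.
  by apply/funext => n /=; rewrite fE.
have mexp : measurable_fun setT (fun w => (expR (gam * k w))%:E).
  apply/measurable_EFinP; apply: measurableT_comp => //.
  by apply: measurable_funM.
have [] := @dominated_convergence _ _ _ nu setT measurableT f_
  (fun w => (expR (gam * k w))%:E) (cst M%:E) mf mexp.
- apply: aeW => w _; apply/cvg_EFin; first by near=> n.
  rewrite (_ : gam * k w = - gam * - k w); last by ring.
  apply: (cvg_comp (fun n => u (n + N)%N) _ _ (@mu_long (- k w))).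
  by rewrite cvg_shiftn.
- by apply: finite_measure_integrable_cst.
- apply: filterS kA => w kwA n _; rewrite /f_ /= lee_fin ger0_norm; last first.
    by rewrite divr_ge0 ?tail_ge0.
  apply: le_trans (NM (n + N)%N (leq_addl _ _)).
  by rewrite ler_pM2r ?invr_gt0 ?long_tail_gt0// tail_nonincr// lerB.
move=> iexp _ cv; apply: fine_cvg.
by rewrite /Rintegral fineK//; exact: integrable_fin_num.
Unshelve. all: by end_near. Qed.

End long_tail.

(** The map sending [a] to [r * a + q] contracts towards its fixed point [q / (1 - r)], and a small
    enough slack [e] at each step keeps the limit of the iterates below [b]. *)
Lemma affine_iteration_upper (R : realType) (U : R -> Prop) (r q : R) :
  0 <= r -> r < 1 -> (exists a, U a) ->
  (forall a b, U a -> a <= b -> U b) ->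
  (forall a e, U a -> 0 < e -> U (r * a + q + e)) ->
  forall b, q / (1 - r) < b -> U b.
Proof.
move=> r0 r1 [a Ua] Ule Ustep b qb.
have r1' : 1 - r != 0 by rewrite subr_eq0 eq_sym lt_eqF.
set c := q / (1 - r) in qb.
have cq : q = c * (1 - r) by rewrite /c mulfVK.
(* The midpoint is the fixed point of the map with slack [e = (b - c) / 2 * (1 - r)], so each step
   multiplies the distance to [c'] by [r]. *)
pose c' := (b + c) / 2.
have Un n : U (c' + r ^+ n * (a - c')).
  elim: n => [|n IH]; first by rewrite expr0 mul1r addrC subrK.
  rewrite (_ : _ + _ = r * (c' + r ^+ n * (a - c')) + q + (b - c) / 2 * (1 - r)).
    by apply: Ustep => //; rewrite !mulr_gt0 ?subr_gt0// invr_gt0.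
  by rewrite cq /c' exprS; field.
have rn : r ^+ n * (a - c') @[n --> \oo] --> 0.
  rewrite -[X in _ --> X](mul0r (a - c')); apply: cvgMl; apply: cvg_expr.
  by rewrite ger0_norm.
have bc : 0 < (b - c) / 2 by rewrite divr_gt0 ?subr_gt0.
move/cvgr_le : rn => /(_ _ bc)[n _ /(_ _ (leqnn n)) nb].
apply: Ule (Un n) _; rewrite -lerBrDl (le_trans nb)//= /c'; lra.
Qed.

(** * Exponential moments and their truncations *)

Section exponential_moments.
Variables (R : realType) (m : probability R R).

Lemma measurable_expR_comp (k : R -> R) : measurable_fun setT k ->
  measurable_fun setT (fun w => expR (k w)).
Proof. by move=> mk; exact: measurableT_comp. Qed.

(** A zero integral would make the exponential vanish almost everywhere; as it vanishes nowhere, the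
    whole space would be null. *)
Lemma Rintegral_expR_gt0 (k : R -> R) : measurable_fun setT k ->
  m.-integrable setT (fun w => (expR (k w))%:E) ->
  0 < \int[m]_w expR (k w).
Proof.
move=> mk ik; rewrite lt_neqAle Rintegral_ge0 ?andbT; last first.
  by move=> w _; exact: expR_ge0.
apply/eqP => k0.
have : (\int[m]_w `|(expR (k w))%:E|)%E = 0%E.
  under eq_integral do rewrite gee0_abs ?lee_fin ?expR_ge0//.
  by rewrite -[LHS]fineK ?integrable_fin_num// -[fine _]k0.
move/ae_eq_integral_abs => /(_ measurableT).
have mE : measurable_fun setT (fun w => (expR (k w))%:E).
  by apply/measurable_EFinP; exact: measurable_expR_comp.
move=> /(_ mE) [N [mN N0 /(_ _) sub]].
have : m setT = 0%E.
  apply/eqP; rewrite -measure_le0 -N0 le_measure ?inE// => w _.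
  by apply: sub => /= /(_ I) -[] h; have := expR_gt0 (k w); rewrite h ltxx.
by rewrite probability_setT => -[] /eqP; rewrite oner_eq0.
Qed.

Lemma measurable_min_cst (A : R) : measurable_fun setT (fun w : R => Num.min w A).
Proof. by apply: measurable_minr. Qed.

Lemma integrable_expR_bounded (gam A : R) (k : R -> R) : 0 <= gam ->
  measurable_fun setT k -> {ae m, forall w, k w <= A} ->
  m.-integrable setT (fun w => (expR (gam * k w))%:E).
Proof.
move=> g0 mk kA.
have mE : measurable_fun setT (fun w => (expR (gam * k w))%:E).
  apply/measurable_EFinP; apply: measurable_expR_comp.
  exact: measurable_funM.
apply/integrableP; split => //.
apply: (@le_lt_trans _ _ (\int[m]_w (expR (gam * A))%:E)%E).
  apply: ae_ge0_le_integral => //.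
  - exact: measurableT_comp.
  - move: kA; apply: filterS => w kw _; rewrite gee0_abs ?lee_fin ?expR_ge0//.
    by rewrite ler_expR ler_wpM2l.
by rewrite integral_cst//= probability_setT mule1 ltry.
Qed.

(** Capping [w] at [A] keeps the integrand bounded for [gam >= 0], so the quantity is usable for the
    law of W before its exponential moment is known to be finite. *)
Definition trunc_mgf (gam A : R) : R := \int[m]_w expR (gam * Num.min w A).

Lemma integrable_trunc_mgf (gam A : R) : 0 <= gam ->
  m.-integrable setT (fun w => (expR (gam * Num.min w A))%:E).
Proof.
move=> g0; apply: (integrable_expR_bounded (A := A)) => //.
  exact: measurable_min_cst.
by apply: aeW => w; rewrite ge_min lexx orbT.
Qed.

Let cvg_integrand (gam w : R) :
  (expR (gam * Num.min w n%:R))%:E @[n --> \oo] --> (expR (gam * w))%:E.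
Proof.
apply: cvg_near_cst; near=> n; rewrite /= min_l//.
by near: n; exact: nbhs_infty_ger.
Unshelve. all: by end_near. Qed.

Let measurable_integrand (gam : R) (n : nat) :
  measurable_fun setT (fun w : R => (expR (gam * Num.min w n%:R))%:E).
Proof.
apply/measurable_EFinP; apply: measurable_expR_comp.
by apply: measurable_funM => //; exact: measurable_min_cst.
Qed.

Let measurable_expM (gam : R) : measurable_fun setT (fun w : R => (expR (gam * w))%:E).
Proof.
apply/measurable_EFinP; apply: measurable_expR_comp.
exact: measurable_funM.
Qed.

Lemma trunc_mgf_cvg (gam : R) : 0 <= gam -> (mgf m gam < +oo)%E ->
  trunc_mgf gam n%:R @[n --> \oo] --> fine (mgf m gam).
Proof.
move=> g0 mfin.
have iexp : m.-integrable setT (fun w => (expR (gam * w))%:E).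
  apply/integrableP; split => //.
  by under eq_integral do rewrite gee0_abs ?lee_fin ?expR_ge0//.
have [] := @dominated_convergence _ _ _ m setT measurableT
  (fun n w => (expR (gam * Num.min w n%:R))%:E) (fun w => (expR (gam * w))%:E)
  (fun w => (expR (gam * w))%:E) (measurable_integrand gam) (measurable_expM gam).
- by apply: aeW => w _; exact: cvg_integrand.
- exact: iexp.
- apply: aeW => w n _ /=; rewrite lee_fin ger0_norm ?expR_ge0// ler_expR.
  by rewrite ler_wpM2l// ge_min lexx.
move=> _ _ cv; apply: fine_cvg.
by rewrite fineK//; exact: integrable_fin_num.
Qed.

(** The truncated exponentials increase to the full one, so a bound uniform in [n] passes to the
    limit by monotone convergence. *)
Lemma mgf_lty_trunc (gam K : R) : 0 <= gam ->
  (forall n, trunc_mgf gam n%:R <= K) -> (mgf m gam < +oo)%E.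
Proof.
move=> g0 JK; apply: (@le_lt_trans _ _ K%:E); last exact: ltry.
have -> : mgf m gam =
    (\int[m]_w limn (fun n => (expR (gam * Num.min w n%:R))%:E))%E.
  by apply: eq_integral => w _; apply/esym/cvg_lim => //; exact: cvg_integrand.
have cv := @cvg_monotone_convergence _ _ _ m _ measurableT _ (measurable_integrand gam).
apply: (cvge_to_le (cv _ _)).
- by move=> n w _; rewrite lee_fin expR_ge0.
- move=> w _ a b ab; rewrite lee_fin ler_expR ler_wpM2l// le_min ge_min lexx/=.
  by rewrite ge_min ler_nat ab orbT.
- apply: nearW => n; rewrite -[leLHS]fineK ?lee_fin ?JK//.
  by apply: integrable_fin_num => //; exact: integrable_trunc_mgf.
Qed.
End exponential_moments.

(** * Comparison of lower convolutions *)

Section lower_conv_bounds.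
Variables (R : realType) (mu nu1 nu2 : probability R R) (a b A x : R).

(** Where the indicator is 1 one has [A <= x - u], so a bound beyond [A] is enough; where it is 0
    the comparison reduces to [0 <= b]. The error [b] is not enlarged because [mu] has mass 1. *)
Lemma lower_conv_le : 0 <= b ->
  (forall y : R, A <= y -> tail nu1 y <= a * tail nu2 y + b) ->
  lower_conv mu nu1 A x <= a * lower_conv mu nu2 A x + b.
Proof.
move=> b0 ab; have i2 := integrable_lower_integrand mu nu2 A x.
have ia : mu.-integrable setT
    (EFin \o (fun u : R => a * (tail nu2 (x - u) * (u <= x - A)%R%:R))).
  by have := integrableZl measurableT a i2.
have ib : mu.-integrable setT (EFin \o (fun _ : R => b)).
  by apply: finite_measure_integrable_cst.
rewrite (_ : _ + b = \int[mu]_u (a * (tail nu2 (x - u) * (u <= x - A)%R%:R) + b)).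
  apply: le_Rintegral => //.
  - exact: integrable_lower_integrand.
  - by have := integrableD measurableT ia ib.
  - move=> u _; have [uA|_] := boolP (u <= x - A).
      by rewrite !mulr1 ab//; lra.
    by rewrite !mulr0 add0r.
rewrite RintegralD// RintegralZl// Rintegral_cst//= probability_setT.
by rewrite mulr1.
Qed.

Lemma lower_conv_ge :
  (forall y : R, A <= y -> a * tail nu2 y <= tail nu1 y) ->
  a * lower_conv mu nu2 A x <= lower_conv mu nu1 A x.
Proof.
move=> ab; have i2 := integrable_lower_integrand mu nu2 A x.
rewrite /lower_conv -RintegralZl//; apply: le_Rintegral => //.
- by have := integrableZl measurableT a i2.
- exact: integrable_lower_integrand.
- move=> u _; have [uA|_] := boolP (u <= x - A).
    by rewrite !mulr1 ab//; lra.
  by rewrite !mulr0.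
Qed.

End lower_conv_bounds.

(** [tail_add] with both laws equal to [mu] is solved for the lower part: the limits of the other
    two terms come from [in_S] and [tail_ratio_cvg]. *)
Lemma lower_conv_cvg (R : realType) (mu : probability R R) (gam A : R) :
  0 < gam -> in_S mu gam ->
  lower_conv mu mu A x / tail mu x @[x --> +oo] -->
    2 * fine (mgf mu gam) - trunc_mgf mu gam A.
Proof.
move=> g0 [mfin [mu_long mu2]].
have phi0 : 0 < fine (mgf mu gam).
  apply: Rintegral_expR_gt0; first exact: measurable_funM.
  apply/integrableP; split.
    by apply/measurable_EFinP; apply: measurable_expR_comp; exact: measurable_funM.
  by under eq_integral do rewrite gee0_abs ?lee_fin ?expR_ge0//.
have mu0 := long_tail_gt0 mu_long.
have up : (\int[mu]_w tail mu (x - Num.min w A)) / tail mu x @[x --> +oo] -->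
    trunc_mgf mu gam A.
  apply: (tail_ratio_cvg mu_long (A := A)); first exact: measurable_min_cst.
  by apply: aeW => w; rewrite ge_min lexx orbT.
(* [asym_equiv] gives the limit of the quotient by [2 * phi * tail mu x], so this factor is divided
   out and restored, which requires [phi0]. *)
rewrite (_ : (fun x => _) = (fun x => 2 * fine (mgf mu gam) *
    (fine ((mu \x mu)%E [set z : R * R | x < z.1 + z.2]) /
      (2 * fine (mgf mu gam) * tail mu x)) -
    (\int[mu]_w tail mu (x - Num.min w A)) / tail mu x)); last first.
  apply/funext => x; rewrite (tail_add mu mu A).
  by have := mu0 x; move: (tail mu x) => t t0; field; rewrite !gt_eqF.
apply: cvgB => //; rewrite -[X in _ --> X]mulr1; apply: cvgM => //.
exact: cvg_cst.
Qed.

(** * Asymptotics of a tail that satisfies the stationary recursion *)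

Section stationary_tail.
Variables (R : realType) (mu nu : probability R R) (p gam : R).
Hypotheses (p_ge0 : 0 <= p) (p_lt1 : p < 1) (gam_gt0 : 0 < gam).
Hypothesis muS : in_S mu gam.
Let phi := fine (mgf mu gam).
Hypothesis pphi : p * phi < 1.
Hypothesis nu_ge0 : {ae nu, forall w, 0 <= w}.
Hypothesis stat : forall x : R, 0 <= x -> tail nu x =
  p * fine ((mu \x nu)%E [set z : R * R | x < z.1 + z.2]) +
  (1 - p) * fine ((mu \x nu)%E [set z : R * R | x < z.1 - z.2]).

Let F := tail mu.
Let f := tail nu.
Let T A x := \int[nu]_w F (x - Num.min w A).
Let V x := \int[nu]_w F (x - (- w)).
Let e := \int[nu]_w expR (gam * (- w)).

Let mu_long (y : R) : F (x + y) / F x @[x --> +oo] --> expR (- gam * y).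
Proof. by case: muS => _ [+ _]; exact. Qed.

Let F_gt0 x : 0 < F x.
Proof. exact: long_tail_gt0 mu_long _. Qed.

Let phi_ge0 : 0 <= phi.
Proof. by rewrite fine_ge0// integral_ge0// => x _; rewrite lee_fin expR_ge0. Qed.

Let recursion (A x : R) : 0 <= x ->
  f x = p * (lower_conv mu nu A x + T A x) + (1 - p) * V x.
Proof. by move=> x0; rewrite /f stat// (tail_add mu nu A) tail_sub. Qed.

Let T_cvg A : T A x / F x @[x --> +oo] --> trunc_mgf nu gam A.
Proof.
apply: (tail_ratio_cvg mu_long (A := A)); first exact: measurable_min_cst.
by apply: aeW => w; rewrite ge_min lexx orbT.
Qed.

Let V_cvg : V x / F x @[x --> +oo] --> e.
Proof.
apply: (tail_ratio_cvg mu_long (A := 0)) => //.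
by apply: filterS nu_ge0 => w; rewrite oppr_le0.
Qed.

Let lower_cvg A : lower_conv mu mu A x / F x @[x --> +oo] -->
  2 * phi - trunc_mgf mu gam A.
Proof. exact: lower_conv_cvg. Qed.

Let T_ge0 A x : 0 <= T A x.
Proof. by apply: Rintegral_ge0 => w _; exact: tail_ge0. Qed.

Let V_ge0 x : 0 <= V x.
Proof. by apply: Rintegral_ge0 => w _; exact: tail_ge0. Qed.

Let ratio_le (h : R -> R) (l l' : R) : h x / F x @[x --> +oo] --> l -> l < l' ->
  \forall x \near +oo, h x <= l' * F x.
Proof.
move=> /cvgr_le + ll' => /(_ _ ll'); apply: filterS => x.
by rewrite ler_pdivrMr.
Qed.

Let ratio_ge (h : R -> R) (l l' : R) : h x / F x @[x --> +oo] --> l -> l' < l ->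
  \forall x \near +oo, l' * F x <= h x.
Proof.
move=> /cvgr_ge + ll' => /(_ _ ll'); apply: filterS => x.
by rewrite ler_pdivlMr.
Qed.

(** This is the starting value for the upper iteration. As [A] grows,
    [p * (2 * phi - trunc_mgf mu gam A)] tends to [p * phi < 1], so some fixed [A] makes the
    recursion contract; the trivial bound [f <= 1] is then fed through it repeatedly. *)
Lemma tail_bounded : exists2 a : R, 0 <= a & forall x, f x <= a * F x.
Proof.
have [A pA] : exists A, p * (2 * phi - trunc_mgf mu gam A) < 1.
  have : p * (2 * phi - trunc_mgf mu gam n%:R) @[n --> \oo] --> p * (2 * phi - phi).
    apply: cvgMr; apply: cvgB; first exact: cvg_cst.
    by apply: trunc_mgf_cvg; [exact: ltW|case: muS].
  rewrite (_ : p * (2 * phi - phi) = p * phi); last by ring.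
  move/cvgr_lt => /(_ _ pphi)[n _ /(_ _ (leqnn n)) nP].
  by exists n%:R.
have [r r1 L1] : exists2 r : R, r < 1 &
    \forall x \near +oo, p * lower_conv mu mu A x <= r * F x.
  move: pA; set r0 := (p * _); move=> pA; exists ((r0 + 1) / 2); first by lra.
  apply: (@ratio_le _ r0); last by lra.
  by under eq_fun do rewrite -mulrA; apply: cvgM (cvg_cst _) _; exact: lower_cvg.
have e0 : 0 <= e by apply: Rintegral_ge0 => w _; exact: expR_ge0.
have J0 : 0 <= trunc_mgf nu gam A by apply: Rintegral_ge0 => w _; exact: expR_ge0.
have lt_add1 (l : R) : l < l + 1 by rewrite ltrDl.
have L2 := ratio_le (@T_cvg A) (lt_add1 _).
have L3 := ratio_le V_cvg (lt_add1 _).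
have [M [_ MP]] := filterI L1 (filterI L2 L3).
(* Beyond [x0] both the recursion, which needs [0 <= x], and the three asymptotic bounds, which need
   [M < x], are available. *)
pose x0 := Num.max M 0 + 1.
(* The first terms dominate [T A x / F x] and [V x / F x] with slack 1 each; the last one gives
   [f x <= 1 <= K * F x] for [x <= x0]. *)
pose K := trunc_mgf nu gam A + 1 + (e + 1) + (F x0)^-1.
have F0 : 0 < (F x0)^-1 by rewrite invr_gt0.
have K0 : 0 <= K by rewrite /K; lra.
have [a [a0 ra aK]] : exists a : R, [/\ 0 <= a, a * r + K <= a & K <= a].
  (* The first summand absorbs [K] in [a * r + K <= a]; the second gives [K <= a] whatever the sign
     of [r]. *)
  exists (K / (1 - r) + K); have Kr : 0 <= K / (1 - r) by rewrite divr_ge0//; lra.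
  split; [exact: addr_ge0| |by rewrite lerDr].
  rewrite -subr_ge0 (_ : _ - _ = K * (1 - r)); first by rewrite mulr_ge0//; lra.
  by field; lra.
have small (x : R) : x <= x0 -> f x <= K * F x.
  move=> xx0; apply: (le_trans (tail_le1 _ _)).
  apply: (@le_trans _ _ ((F x0)^-1 * F x)).
    by rewrite mulrC ler_pdivlMr// mul1r tail_nonincr.
  by rewrite ler_pM2r// /K; lra.
(* The pair (a, p ^ n) is propagated: the coefficient of F stays at the fixed
   value a because a * r + K <= a, while the additive error shrinks by p. *)
have geom n x : f x <= a * F x + p ^+ n.
  elim: n x => [|n IH] x.
    rewrite expr0 (le_trans (tail_le1 _ _))// lerDr mulr_ge0//.
    exact: ltW.
  have pn0 k : 0 <= p ^+ k by rewrite exprn_ge0.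
  have [xx0|xx0] := lerP x x0.
    rewrite (le_trans (small _ xx0))// ler_wpDr// ler_wpM2r//; exact: ltW.
  have [xge0 Mx] : 0 <= x /\ M < x.
    have : M <= Num.max M 0 by rewrite le_max lexx.
    have : 0 <= Num.max M 0 by rewrite le_max lexx orbT.
    by move: xx0; rewrite /x0; lra.
  have /= [l1 [l2 l3]] := MP _ Mx.
  rewrite (recursion A)//.
  have lc := lower_conv_le mu x (pn0 n) (fun y (_ : A <= y) => IH y).
  have pT : p * T A x <= T A x by rewrite ler_piMl// ltW.
  have pV : (1 - p) * V x <= V x by rewrite ler_piMl// lerBlDr lerDl.
  have plc : p * lower_conv mu nu A x <= a * (r * F x) + p ^+ n.+1.
    apply: (le_trans (ler_wpM2l p_ge0 lc)).
    by rewrite mulrDr -exprS lerD2r mulrCA ler_wpM2l.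
  have KF : (trunc_mgf nu gam A + 1) * F x + (e + 1) * F x <= K * F x.
    by rewrite -mulrDl ler_pM2r// /K; lra.
  have : (a * r + K) * F x <= a * F x by rewrite ler_pM2r.
  by move: plc; rewrite mulrDl [p * (_ + _)]mulrDr mulrA; lra.
exists a => // x; apply/ler_addgt0Pr => eps eps0.
have : p ^+ n @[n --> \oo] --> 0 by apply: cvg_expr; rewrite ger0_norm.
move=> /cvgr_le/(_ _ eps0)[n _ /(_ _ (leqnn n)) nP].
by apply: (le_trans (geom n x)); rewrite lerD2l.
Qed.

(** This is the right side of [recursion] with [lower_conv mu nu] replaced by
    [a * lower_conv mu mu], as a comparison of [f] with [a * F] allows; [G a A] is the limit of its
    ratio to [F]. *)
Let g a A x := p * (a * lower_conv mu mu A x + T A x) + (1 - p) * V x.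

Let G a A := p * (a * (2 * phi - trunc_mgf mu gam A) + trunc_mgf nu gam A) +
  (1 - p) * e.

Let g_cvg a A : g a A x / F x @[x --> +oo] --> G a A.
Proof.
rewrite (_ : (fun x => _) = (fun x => p * (a * (lower_conv mu mu A x / F x) +
    T A x / F x) + (1 - p) * (V x / F x))); last first.
  by apply/funext => x; rewrite /g; field; rewrite gt_eqF.
apply: cvgD; apply: cvgM (cvg_cst _) _; last exact: V_cvg.
by apply: cvgD; [apply: cvgM (cvg_cst _) _; exact: lower_cvg|exact: T_cvg].
Qed.

Let tail_le_g a A x : 0 <= x ->
  (forall y : R, A <= y -> f y <= a * F y) -> f x <= g a A x.
Proof.
move=> x0 fa; rewrite (recursion A)// lerD2r ler_wpM2l// lerD2r -[leRHS]addr0.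
by apply: lower_conv_le => // y Ay; rewrite addr0 fa.
Qed.

Let tail_ge_g a A x : 0 <= x ->
  (forall y : R, A <= y -> a * F y <= f y) -> g a A x <= f x.
Proof.
move=> x0 fa; rewrite (recursion A)// lerD2r ler_wpM2l// lerD2r.
exact: lower_conv_ge.
Qed.

(** All terms of the recursion are nonnegative, so [p * T A x <= f x <= a * F x] with [a]
    independent of [A]. Dividing by [F x] and letting [x] grow bounds the truncated moment. *)
Let trunc_mgf_bounded : exists a : R, forall A, p * trunc_mgf nu gam A <= a.
Proof.
have [a a0 fa] := tail_bounded; exists a => A.
rewrite leNgt; apply/negP => aA.
have pT : p * T A x / F x @[x --> +oo] --> p * trunc_mgf nu gam A.
  under eq_fun do rewrite -mulrA.
  by apply: cvgM (cvg_cst _) _; exact: T_cvg.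
have aa : (a + p * trunc_mgf nu gam A) / 2 < p * trunc_mgf nu gam A by lra.
have [M [_ MP]] := ratio_ge pT aa.
pose x := Num.max M 0 + 1.
have Mx : M < x by rewrite /x ltr_pwDr// le_max lexx.
have x0 : 0 <= x by rewrite /x addr_ge0// le_max lexx orbT.
have /= := MP _ Mx; apply/negP; rewrite -ltNge.
apply: (@le_lt_trans _ _ (a * F x)); last by rewrite ltr_pM2r//; lra.
apply: le_trans (fa x); rewrite (recursion A)// mulrDr -addrA addrCA lerDl.
rewrite addr_ge0// mulr_ge0// ?subr_ge0; [|exact: ltW].
by apply: Rintegral_ge0 => u _; rewrite mulr_ge0// tail_ge0.
Qed.

Lemma stationary_mgf_lty : 0 < p -> (mgf nu gam < +oo)%E.
Proof.
move=> p0; have [a pa] := trunc_mgf_bounded.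
apply: (@mgf_lty_trunc _ _ _ (a / p)); first exact: ltW.
by move=> n; rewrite ler_pdivlMr// mulrC.
Qed.

(** Finiteness of [mgf nu gam] has been derived for [0 < p]. The factor [p] is kept so that both
    sides vanish at [p = 0], whatever [fine] returns. *)
Let trunc_mgf_nu_cvg :
  p * trunc_mgf nu gam n%:R @[n --> \oo] --> p * fine (mgf nu gam).
Proof.
have [p0|p0] := eqVneq p 0.
  rewrite p0 mul0r (_ : (fun n => _) = cst 0); first exact: cvg_cst.
  by apply/funext => n; rewrite mul0r.
have {}p0 : 0 < p by rewrite lt_neqAle eq_sym p0.
apply: cvgM (cvg_cst _) _; apply: trunc_mgf_cvg; first exact: ltW.
exact: stationary_mgf_lty.
Qed.

Let q := p * fine (mgf nu gam) + (1 - p) * e.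

Let G_cvg a : G a n%:R @[n --> \oo] --> p * phi * a + q.
Proof.
have Jmu : trunc_mgf mu gam n%:R @[n --> \oo] --> phi.
  by apply: trunc_mgf_cvg; [exact: ltW|case: muS].
rewrite (_ : (fun n => _) = (fun n => p * a * (2 * phi - trunc_mgf mu gam n%:R) +
    (p * trunc_mgf nu gam n%:R + (1 - p) * e))); last first.
  by apply/funext => n; rewrite /G; ring.
rewrite (_ : p * phi * a + q = p * a * (2 * phi - phi) + q); last by ring.
apply: cvgD; last by apply: cvgD => //; exact: cvg_cst.
by apply: cvgM (cvg_cst _) _; apply: cvgB => //; exact: cvg_cst.
Qed.

Let near_ge0 : \forall x \near +oo, 0 <= x :> R.
Proof. by apply: nbhs_pinfty_ge; rewrite num_real. Qed.

(** A single integer level must lie beyond the threshold of [Q] and also bring [G a A] into the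
    prescribed neighbourhood of its limit. *)
Let pick_level (Q : R -> Prop) (a : R) (S : set R) :
  (\forall x \near +oo, Q x) -> nbhs (p * phi * a + q) S ->
  exists2 A, S (G a A) & forall y, A <= y -> Q y.
Proof.
move=> [M [_ MQ]] /(@G_cvg a) SG.
have {}SG : \forall n \near \oo, S (G a n%:R) by exact: SG.
have MN : \forall n \near \oo, M < n%:R by exact: nbhs_infty_gtr.
have [n _ /(_ _ (leqnn n)) [/= Sn Mn]] := filterI SG MN.
by exists n%:R => // y ny; apply: MQ; exact: lt_le_trans ny.
Qed.

Let upper a eps : (\forall x \near +oo, f x <= a * F x) -> 0 < eps ->
  \forall x \near +oo, f x <= (p * phi * a + q + eps) * F x.
Proof.
move=> Ua eps0.
have [|A GA fA] := pick_level (a := a) (S := [set y | y < p * phi * a + q + eps]) Ua.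
  by apply: lt_nbhsl; rewrite ltrDl.
near=> x; apply: (@le_trans _ _ (g a A x)).
  by apply: tail_le_g => //; near: x.
by near: x; apply: ratio_le (@g_cvg a A) _.
Unshelve. all: by end_near. Qed.

Let lower a eps : (\forall x \near +oo, a * F x <= f x) -> 0 < eps ->
  \forall x \near +oo, (p * phi * a + q - eps) * F x <= f x.
Proof.
move=> Ua eps0.
have [|A GA fA] := pick_level (a := a) (S := [set y | p * phi * a + q - eps < y]) Ua.
  by apply: lt_nbhsr; rewrite ltrBlDr ltrDl.
near=> x; apply: (@le_trans _ _ (g a A x)); last first.
  by apply: tail_ge_g => //; near: x.
by near: x; apply: ratio_ge (@g_cvg a A) _.
Unshelve. all: by end_near. Qed.

Let pphi_ge0 : 0 <= p * phi. Proof. exact: mulr_ge0. Qed.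

Let tail_ratio : f x / F x @[x --> +oo] --> q / (1 - p * phi).
Proof.
apply/cvgrPdist_le => eps eps0.
have ub : \forall x \near +oo, f x <= (q / (1 - p * phi) + eps) * F x.
  apply: (@affine_iteration_upper _ (fun a => \forall x \near +oo, f x <= a * F x)
    (p * phi) q) => //.
  - by have [a _ fa] := tail_bounded; exists a; exact: nearW.
  - move=> a b ab_ ab; apply: filterS ab_ => x fx; apply: (le_trans fx).
    by rewrite ler_pM2r.
  - by rewrite ltrDl.
have lb : \forall x \near +oo, (q / (1 - p * phi) - eps) * F x <= f x.
  (* Lower bounds are turned into upper ones by a sign change: the iteration runs on [- a] with
     [- q], and starts from the trivial bound [0 <= f]. *)
  rewrite (_ : _ - eps = - (- q / (1 - p * phi) + eps)); last first.
    by rewrite mulNr opprD opprK.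
  apply: (@affine_iteration_upper _ (fun a => \forall x \near +oo, - a * F x <= f x)
    (p * phi) (- q)) => //.
  - by exists 0; apply: nearW => x; rewrite oppr0 mul0r tail_ge0.
  - move=> a b ab_ ab; apply: filterS ab_ => x fx; apply: le_trans fx.
    by rewrite ler_pM2r// lerN2.
  - move=> a d Ua d0; rewrite (_ : - _ = p * phi * - a + q - d); last by ring.
    exact: lower.
  - by rewrite ltrDl.
near=> x.
rewrite distrC ler_distl ler_pdivlMr// ler_pdivrMr//; apply/andP; split; near: x.
  exact: lb.
exact: ub.
Unshelve. all: by end_near. Qed.

(** Passing from the limit of [f / F] to [asym_equiv] divides by the constant, which must be
    nonzero; it is positive because [e > 0] and [p < 1]. *)
Lemma stationary_tail_equiv :
  asym_equiv (tail nu) (fun x =>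
    (p * fine (mgf nu gam) + (1 - p) * \int[nu]_w expR (gam * (- w))) /
      (1 - p * fine (mgf mu gam)) * tail mu x).
Proof.
have e0 : 0 < e.
  apply: Rintegral_expR_gt0; first by apply: measurable_funM => //; exact: measurable_funN.
  apply: (integrable_expR_bounded (A := 0)) => //; first exact: ltW.
  by apply: filterS nu_ge0 => w; rewrite oppr_le0.
have q0 : 0 < q.
  rewrite ltr_wpDl//; last by rewrite mulr_gt0// subr_gt0.
  by rewrite mulr_ge0// fine_ge0// integral_ge0// => x _; rewrite lee_fin expR_ge0.
have pphi0 : 0 < 1 - p * phi by rewrite subr_gt0.
have c0 : q / (1 - p * phi) != 0 by rewrite gt_eqF// divr_gt0.
rewrite /asym_equiv -[X in _ --> X](mulfV c0) -/f -/F -/e -/phi -/q.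
rewrite (_ : (fun x => _) = (fun x => f x / F x * (q / (1 - p * phi))^-1)); last first.
  by apply/funext => x; rewrite invfM mulrA mulrAC.
by apply: cvgM; [exact: tail_ratio|exact: cvg_cst].
Qed.

End stationary_tail.

(** * Integrals against joint laws of independent variables *)

Lemma eq_integral_prod d1 d2 (T1 : measurableType d1) (T2 : measurableType d2)
    (R : realType) (m1 : probability T1 R) (m2 : probability T2 R)
    (q : probability (T1 * T2)%type R) (h : T1 * T2 -> \bar R) :
  (forall A B, measurable A -> measurable B -> q (A `*` B) = m1 A * m2 B)%E ->
  measurable_fun setT h -> (forall z, 0 <= h z)%E ->
  (\int[q]_z h z = \int[m1]_x \int[m2]_y h (x, y))%E /\
  (\int[q]_z h z = \int[m2]_y \int[m1]_x h (x, y))%E.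
Proof.
move=> qE mh h0.
have -> : (\int[q]_z h z = \int[m1 \x m2]_z h z)%E.
  apply: eq_measure_integral => D mD _.
  by apply/esym; apply: product_measure_unique.
by split; [rewrite fubini_tonelli1|rewrite fubini_tonelli2].
Qed.

Section joint_law.
Context {d : measure_display} {T : measurableType d} {R : realType}.
Variables (P : probability T R) (V X W : {RV P >-> R}).
Hypothesis indep : forall A B C : set R,
  measurable A -> measurable B -> measurable C ->
  P (V @^-1` A `&` X @^-1` B `&` W @^-1` C) =
  (P (V @^-1` A) * P (X @^-1` B) * P (W @^-1` C))%E.

Definition pair_RV (t : T) : R * R := (X t, W t).

Let measurable_pair_RV : measurable_fun setT pair_RV.
Proof. exact: measurable_fun_pair. Qed.

HB.instance Definition _ :=
  isMeasurableFun.Build _ _ _ _ pair_RV measurable_pair_RV.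

(** The nesting isolates [V], to be taken as [E] or [Y], from the pair with law [mu \x nu]. *)
Definition triple_RV (t : T) : R * (R * R) := (V t, pair_RV t).

Let measurable_triple_RV : measurable_fun setT triple_RV.
Proof. exact: measurable_fun_pair. Qed.

HB.instance Definition _ :=
  isMeasurableFun.Build _ _ _ _ triple_RV measurable_triple_RV.

Let mu : probability R R := distribution P X.
Let nu : probability R R := distribution P W.
Let mu_nu : probability (R * R)%type R := (mu \x nu)%E.

Let pair_law (A : set R) (D : set (R * R)) : measurable A -> measurable D ->
  P (V @^-1` A `&` pair_RV @^-1` D) = (P (V @^-1` A) * (mu \x nu) D)%E.
Proof.
move=> mA mD.
have mVA : measurable (V @^-1` A) by exact: measurable_funPTI.
have k0 : 0 <= fine (P (V @^-1` A)) by rewrite fine_ge0.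
transitivity ((mscale (NngNum k0) mu \x nu)%E D); last first.
  rewrite /product_measure1 ge0_integral_mscale//=; last first.
    exact: measurable_fun_xsection.
  by rewrite fineK// fin_num_measure.
apply/esym; rewrite [RHS](_ : _ = pushforward (mrestr P mVA) pair_RV D); last first.
  by rewrite /pushforward /mrestr setIC.
apply: product_measure_unique => // B C mB mC.
rewrite /pushforward /mrestr/= /mscale/= fineK ?fin_num_measure// -indep//.
by congr (P _); apply/seteqP; split => t /=; rewrite /pair_RV/=; tauto.
Qed.

(** Both orders serve: [Y] is integrated outermost in [stationary_integral], and [E] innermost in
    [affine_exponential_le0]. *)
Lemma joint_law_integral (h : R * (R * R) -> \bar R) :
  measurable_fun setT h -> (forall z, 0 <= h z)%E ->
  (\int[P]_t h (V t, (X t, W t)) =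
   \int[distribution P V]_v \int[mu \x nu]_z h (v, z))%E /\
  (\int[P]_t h (V t, (X t, W t)) =
   \int[mu \x nu]_z \int[distribution P V]_v h (v, z))%E.
Proof.
move=> mh h0.
have -> : (\int[P]_t h (V t, (X t, W t)) = \int[distribution P triple_RV]_z h z)%E.
  by rewrite ge0_integral_distribution.
apply: (eq_integral_prod (m2 := mu_nu)) => // A B mA mB; exact: pair_law.
Qed.

End joint_law.

(** The two atoms have total mass 1, so their complement is null and only the integrals over two
    singletons remain. *)
Lemma rademacher_integral d (T : measurableType d) (R : realType)
    (P : probability T R) (Y : {RV P >-> R}) (p : R) (G : R -> \bar R) :
  P (Y @^-1` [set 1]) = p%:E -> P (Y @^-1` [set -1]) = (1 - p)%:E ->
  measurable_fun setT G -> (forall y, 0 <= G y)%E ->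
  (\int[distribution P Y]_y G y = p%:E * G 1%R + (1 - p)%:E * G (-1)%R)%E.
Proof.
move=> P1 PN1 mG G0.
have m11 : [set 1 : R] `&` [set -1] = set0.
  by apply/seteqP; split => y //= [-> /eqP]; rewrite gt_eqF.
pose D : set R := [set 1] `|` [set -1].
have mD : measurable D by exact: measurableU.
have PD : distribution P Y D = 1%E.
  rewrite measureU//; rewrite -[LHS]/(P (Y @^-1` [set 1%R]) + P (Y @^-1` [set (-1)%R]))%E.
  by rewrite P1 PN1 -EFinD addrC subrK.
have PDC : distribution P Y (~` D) = 0%E.
  rewrite probability_setC//; rewrite -[X in (_ - X)%E]/(distribution P Y D) PD.
  by rewrite subee.
have dirac_part (c r : R) : P (Y @^-1` [set c]) = r%:E ->
    (\int[distribution P Y]_(y in [set c]) G y = r%:E * G c)%E.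
  move=> Pc; rewrite (eq_integral (cst (G c))); last by move=> y; rewrite inE => ->.
  have := integral_cst (distribution P Y) (measurable_set1 c) (G c).
  by rewrite /= muleC => ->; congr (_ * _)%E.
rewrite -(setUv D) ge0_integral_setU//; [|exact: measurableC|by rewrite setUv|].
- rewrite [X in (_ + X)%E]null_set_integral ?adde0//; last 2 first.
  + exact: measurableC.
  + exact: measurable_funTS.
  rewrite /D ge0_integral_setU//.
  + by rewrite (dirac_part 1 p)// (dirac_part (-1) (1 - p)).
  + exact: measurable_funTS.
  + by apply/disj_set2P.
- by apply/disj_set2P; rewrite setICr.
Qed.

(** The maximum covers [t < 0], where the density vanishes and [1 - expR (- (gam * t))] is
    negative. *)
Lemma exponential_prob_le (R : realType) (gam t : R) : 0 < gam ->
  exponential_prob gam `]-oo, t]%classic = (Num.max (1 - expR (- (gam * t))) 0)%:E.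
Proof.
move=> g0.
have mpdf (D : set R) : measurable_fun D (fun x => (exponential_pdf gam x)%:E).
  by apply: measurable_funTS; apply/measurable_EFinP; exact: measurable_exponential_pdf.
have pdf0 (D : set R) : (forall x, D x -> x < 0) -> exponential_prob gam D = 0%E.
  by move=> D0; apply: integral0_eq => x /D0 x0; rewrite lt0_exponential_pdf.
have [t0|t0|->] := ltrgtP t 0.
- rewrite max_r; last by rewrite subr_le0 -expR0 ler_expR oppr_ge0 ltW// pmulr_rlt0.
  by apply: pdf0 => x /=; rewrite in_itv/= => /le_lt_trans; exact.
- rewrite max_l; last by rewrite subr_ge0 -expR0 ler_expR oppr_le0 ltW// mulr_gt0.
  rewrite (_ : `]-oo, t]%classic = `]-oo, 0[%classic `|` `[0, t]%classic); last first.
    apply/seteqP; split => x /=; rewrite !in_itv/=.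
      by move=> ->; rewrite andbT; have [?|?] := ltP x 0; [left|right].
    by case=> [x0|/andP[]//]; rewrite (le_trans (ltW x0))// ltW.
  rewrite /exponential_prob ge0_integral_setU//.
  + rewrite -!/(exponential_prob _ _) exponential_prob_itv0c// mulNr.
    by rewrite pdf0 ?add0e// => x /=; rewrite in_itv.
  + exact: mpdf.
  + by move=> x _; rewrite lee_fin exponential_pdf_ge0// ltW.
  + apply/disj_set2P/seteqP; split => x //=; rewrite !in_itv/= => -[x0].
    by move=> /andP[]; rewrite leNgt x0.
- rewrite mulr0 oppr0 expR0 subrr maxxx.
  rewrite (_ : `]-oo, 0]%classic = `]-oo, 0[%classic `|` [set 0]); last first.
    apply/seteqP; split => x /=; rewrite !in_itv/=.
      by rewrite le_eqVlt => /orP[/eqP|]; [right|left].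
    by case=> [/ltW//|->].
  rewrite /exponential_prob ge0_integral_setU//.
  + rewrite integral_set1 adde0 -/(exponential_prob _ _).
    by rewrite pdf0// => x /=; rewrite in_itv.
  + exact: mpdf.
  + by move=> x _; rewrite lee_fin exponential_pdf_ge0// ltW.
  + apply/disj_set2P/seteqP; split => x //=; rewrite !in_itv/= => -[x0 x00].
    by rewrite x00 ltxx in x0.
Qed.

Lemma prod_exp_affine_integral (R : realType) (mu nu : probability R R) (g s : R) :
  (\int[mu \x nu]_z (expR (g * (s * z.2 + z.1)))%:E =
   mgf mu g * \int[nu]_w (expR (g * (s * w)))%:E)%E.
Proof.
have m1 (c : R) : measurable_fun setT (fun w : R => (expR (g * (c * w)))%:E).
  apply/measurable_EFinP; apply: measurableT_comp => //.
  by apply: measurable_funM => //; exact: measurable_funM.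
have e0 (x : R) : (0 <= (expR x)%:E)%E by rewrite lee_fin expR_ge0.
rewrite fubini_tonelli1//=; last first.
  apply/measurable_EFinP; apply: measurableT_comp => //.
  apply: measurable_funM => //; apply: measurable_funD => //.
  exact: measurable_funM.
rewrite /mgf [RHS]muleC -ge0_integralZl//; last 2 first.
- by have := m1 1; under eq_fun do rewrite mul1r.
- by apply: integral_ge0.
apply: eq_integral => x _; rewrite /fubini_F/=.
rewrite [RHS]muleC -ge0_integralZl//.
by apply: eq_integral => w _; rewrite -EFinM -expRD; congr (expR _)%:E; ring.
Qed.

(** * One step of the stationary equation, for integrals and exponential moments *)

Section queue.
Context {d : measure_display} {T : measurableType d} {R : realType}.
Variables (P : probability T R) (X Y W E : {RV P >-> R}) (p gam : R).
Hypothesis gam_gt0 : 0 < gam.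
Hypothesis indep : independent4 P X Y W E.

Let mu : probability R R := distribution P X.
Let nu : probability R R := distribution P W.

Let independent_EXW (A B C : set R) : measurable A -> measurable B -> measurable C ->
  P (E @^-1` A `&` X @^-1` B `&` W @^-1` C) =
  (P (E @^-1` A) * P (X @^-1` B) * P (W @^-1` C))%E.
Proof.
move=> mA mB mC; have := indep mB measurableT mC mA.
rewrite preimage_setT probability_setT mule1 setIT => h.
rewrite (_ : _ `&` _ = X @^-1` B `&` W @^-1` C `&` E @^-1` A).
  by rewrite h muleC muleA.
by apply/seteqP; split => t /=; tauto.
Qed.

Let independent_YXW (A B C : set R) : measurable A -> measurable B -> measurable C ->
  P (Y @^-1` A `&` X @^-1` B `&` W @^-1` C) =
  (P (Y @^-1` A) * P (X @^-1` B) * P (W @^-1` C))%E.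
Proof.
move=> mA mB mC; have := indep mB mA mC measurableT.
rewrite preimage_setT probability_setT mule1 setIT => h.
by rewrite [Y @^-1` A `&` _]setIC h [(P (Y @^-1` A) * _)%E]muleC.
Qed.

Hypothesis E_exponential : forall A : set R, measurable A ->
  P (E @^-1` A) = exponential_prob gam A.

(** Here [s] stands for a value of [Y] and [z] for the pair [(X, W)]. *)
Let affine (s : R) (z : R * R) : R := s * z.2 + z.1.

Let measurable_affine s : measurable_fun setT (affine s).
Proof. by apply: measurable_funD => //; exact: measurable_funM. Qed.

(** Given [(X, W) = z], the event says that [E] is at most [- affine s z], whose probability is the
    exponential distribution function. *)
Lemma affine_exponential_le0 (s : R) :
  P [set t | s * W t + X t + E t <= 0] =
  (\int[mu \x nu]_z (Num.max (1 - expR (gam * affine s z)) 0)%:E)%E.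
Proof.
pose S := [set z : R * (R * R) | affine s z.2 + z.1 <= 0].
have mS : measurable S.
  apply: measurable_set_le => //; apply: measurable_funD => //.
  by apply: (measurableT_comp (measurable_affine s)).
have mh : measurable_fun setT (fun z : R * (R * R) => (\1_S z)%:E : \bar R).
  by apply/measurable_EFinP; exact: measurable_indic.
have h0 z : (0 <= (\1_S z)%:E :> \bar R)%E by rewrite lee_fin.
have [_ h] := joint_law_integral independent_EXW mh h0.
transitivity (\int[P]_t (\1_S (E t, (X t, W t)))%:E)%E.
  rewrite (_ : (fun t => (\1_S (E t, (X t, W t)))%:E) =
      (fun t => (\1_[set t | s * W t + X t + E t <= 0] t)%:E)); last first.
    by apply/funext => t; rewrite !indicE; congr ((nat_of_bool _)%:R%:E); apply/idP/idP;
      rewrite !inE.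
  rewrite integral_indic ?setIT//; apply: measurable_set_le => //.
  by apply: measurable_funD => //; apply: measurable_funD => //; exact: measurable_funM.
rewrite h; apply: eq_integral => z _.
rewrite (_ : (fun x => (\1_S (x, z))%:E) =
    (fun x => (\1_[set` `]-oo, - affine s z]] x)%:E)); last first.
  apply/funext => x; rewrite !indicE; congr ((nat_of_bool _)%:R%:E).
  have -> : (x \in `]-oo, - affine s z]%classic) = (x <= - affine s z).
    by apply/idP/idP; rewrite in_setE/= in_itv.
  have [xz|xz] := leP x (- affine s z).
    by apply: mem_set; rewrite /S/=; lra.
  by apply: memNset; rewrite /S/=; apply/negP; rewrite -ltNge; lra.
rewrite integral_indic// setIT -[LHS]/(P (E @^-1` _)) E_exponential//.
by rewrite exponential_prob_le// mulrN opprK.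
Qed.

(** Pointwise, [expR (gam * Num.max y 0)] is [expR (gam * y)] plus [Num.max (1 - expR (gam * y)) 0].
    The first part factorizes by independence and the second integrates to the probability involving
    [E]. *)
Lemma affine_pos_mgf (s : R) :
  (\int[mu \x nu]_z (expR (gam * Num.max (affine s z) 0))%:E =
   mgf mu gam * \int[nu]_w (expR (gam * (s * w)))%:E +
   P [set t | (s * W t + X t + E t <= 0)%R])%E.
Proof.
rewrite affine_exponential_le0 -prod_exp_affine_integral -ge0_integralD//.
- apply: eq_integral => z _; rewrite -EFinD -/(affine s z); congr EFin.
  have [z0|z0] := leP (affine s z) 0.
    rewrite mulr0 expR0 max_l; first by rewrite addrC subrK.
    by rewrite subr_ge0 -expR0 ler_expR pmulr_rle0.
  rewrite max_r ?addr0// subr_le0 -expR0 ler_expR mulr_ge0//; exact: ltW.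
- apply/measurable_EFinP; apply: measurableT_comp => //.
  by apply: measurable_funM => //; exact: measurable_affine.
- apply/measurable_EFinP; apply: measurable_maxr => //.
  apply: measurable_funB => //; apply: measurableT_comp => //.
  by apply: measurable_funM => //; exact: measurable_affine.
Qed.

Hypothesis P_Y1 : P (Y @^-1` [set 1]) = p%:E.
Hypothesis P_YN1 : P (Y @^-1` [set -1]) = (1 - p)%:E.
Hypothesis stationary : forall A : set R, measurable A ->
  P (W @^-1` A) = P ((fun t => Num.max (Y t * W t + X t) 0) @^-1` A).

(** Used twice: an indicator [k] gives the tail recursion, and an exponential [k] gives the equation
    for the moment of W. *)
Lemma stationary_integral (k : R -> \bar R) :
  measurable_fun setT k -> (forall y, 0 <= k y)%E ->
  (\int[nu]_w k w =
   p%:E * \int[mu \x nu]_z k (Num.max (affine 1 z) 0)%R +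
   (1 - p)%:E * \int[mu \x nu]_z k (Num.max (affine (-1) z) 0)%R)%E.
Proof.
move=> mk k0.
have mstep : measurable_fun setT (fun t => Num.max (Y t * W t + X t) 0).
  by apply: measurable_maxr => //; apply: measurable_funD => //; exact: measurable_funM.
pose h (z : R * (R * R)) := k (Num.max (affine z.1 z.2) 0).
have mh : measurable_fun setT h.
  apply: (measurableT_comp mk); apply: measurable_maxr => //.
  apply: measurable_funD; last exact: (measurableT_comp measurable_fst).
  by apply: measurable_funM => //; exact: (measurableT_comp measurable_snd).
transitivity (\int[pushforward P (fun t => Num.max (Y t * W t + X t) 0)%R]_w k w)%E.
  by apply: eq_measure_integral => A mA _; exact: stationary.
rewrite ge0_integral_pushforward// preimage_setT.
have [+ _] := joint_law_integral independent_YXW mh (fun z => k0 _).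
rewrite /h /affine => ->.
rewrite (rademacher_integral P_Y1 P_YN1)//.
- pose mu_nu : probability (R * R)%type R := (mu \x nu)%E.
  exact: (measurable_fun_fubini_tonelli_F (m2 := mu_nu) h mh (fun z => k0 _)).
- by move=> y; apply: integral_ge0.
Qed.

End queue.

(** * Identification of the constant and conclusion *)

Theorem theorem5p3 (R : realType) (d : measure_display) (T : measurableType d)
  (P : probability T R) (X Y W E : {RV P >-> R}) (p gam : R) :
  0 <= p -> p < 1 -> 0 < gam ->
  independent4 P X Y W E ->
  nonlattice (distribution P X) ->
  (0 < P [set t | (X t < 0)%R])%E ->
  P (Y @^-1` [set 1]) = p%:E ->
  P (Y @^-1` [set -1]) = (1 - p)%:E ->
  in_S (distribution P X) gam ->
  p * fine ('E_P[fun t => expR (gam * X t)]) < 1 ->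
  (forall A : set R, measurable A ->
     P (W @^-1` A) = P ((fun t => Num.max (Y t * W t + X t) 0) @^-1` A)) ->
  (forall A : set R, measurable A ->
     P (E @^-1` A) = exponential_prob gam A) ->
  let phi := fine ('E_P[fun t => expR (gam * X t)]) in
  let C := (1 - p) * p / (1 - p * phi) ^+ 2 *
             (fine (P [set t | X t - W t + E t <= 0])
              + p / (1 - p) * fine (P [set t | X t + W t + E t <= 0]))
           + (1 - p) / (1 - p * phi) ^+ 2 * fine ('E_P[fun t => expR (- gam * W t)]) in
  asym_equiv (fun x => fine (P [set t | x < W t]))
             (fun x => C * fine (P [set t | x < X t])).
Proof.
move=> p0 p1 gam0 indep _ _ PY1 PYN1 muS pphi stat Eexp phi C.
pose mu : probability R R := distribution P X.
pose nu : probability R R := distribution P W.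
have expE (Z : {RV P >-> R}) (c : R) :
    ('E_P[fun t => expR (c * Z t)])%E = (\int[distribution P Z]_w (expR (c * w))%:E)%E.
  rewrite unlock ge0_integral_distribution//.
  by apply/measurable_EFinP; apply: measurableT_comp => //; exact: measurable_funM.
have phiE : phi = fine (mgf mu gam) by rewrite /phi expE.
(* The maximum with 0 is never negative, so by stationarity W gives no mass to the negative
   half-line. *)
have nu_ge0 : {ae nu, forall w, 0 <= w}.
  exists `]-oo, 0[%classic; split => //.
    rewrite -[LHS]/(P (W @^-1` _)) stat// (_ : _ @^-1` _ = set0) ?measure0//.
    by apply/seteqP; split => t //=; rewrite in_itv/= gt_max ltxx andbF.
  by move=> w /= /negP; rewrite -ltNge in_itv.
pose e := \int[nu]_w expR (gam * - w).
have eE : fine ('E_P[fun t => expR (- gam * W t)]) = e.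
  rewrite expE /e /Rintegral; congr fine; apply: eq_integral => w _.
  by rewrite mulNr mulrN.
have e_fin : (\int[nu]_w (expR (gam * (-1 * w)))%:E = e%:E)%E.
  rewrite /e /Rintegral fineK.
    by apply: eq_integral => w _; rewrite mulN1r.
  apply: integrable_fin_num => //.
  apply: (integrable_expR_bounded (A := 0)) => //; first exact: ltW.
  by apply: filterS nu_ge0 => w; rewrite oppr_le0.
have tail_stat (x : R) : 0 <= x -> tail nu x =
    p * fine ((mu \x nu)%E [set z : R * R | x < z.1 + z.2]) +
    (1 - p) * fine ((mu \x nu)%E [set z : R * R | x < z.1 - z.2]).
  move=> x0; pose k (w : R) : \bar R := (\1_(`]x, +oo[%classic) w)%:E.
  have mk : measurable_fun setT k by apply/measurable_EFinP; exact: measurable_indic.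
  have k0 w : (0 <= k w)%E by rewrite lee_fin.
  have := stationary_integral indep PY1 PYN1 stat mk k0.
  rewrite integral_indic// setIT => h; rewrite /tail h.
  have tail_part (s : R) : (\int[mu \x nu]_z k (Num.max (s * z.2 + z.1) 0)%R =
      (mu \x nu) [set z : R * R | (x < z.1 + s * z.2)%R])%E.
    rewrite (_ : (fun z => _) = (fun z => (\1_[set z : R * R | x < z.1 + s * z.2] z)%:E)).
      rewrite integral_indic ?setIT//; apply: measurable_set_lt => //.
      by apply: measurable_funD => //; exact: measurable_funM.
    apply/funext => z; rewrite /k !indicE; congr ((nat_of_bool _)%:R%:E).
    (* For [0 <= x], exceeding [x] means the same for a number and for its maximum with 0. *)
    apply/idP/idP; rewrite !in_setE/= in_itv/= andbT lt_max addrC.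
      by case/orP => //; rewrite ltNge x0.
    by move=> ->.
  have fin_mu_nu (S : set (R * R)) : measurable S ->
      (mu \x nu)%E S = (fine ((mu \x nu)%E S))%:E.
    move=> mS; pose mu_nu : probability (R * R)%type R := (mu \x nu)%E.
    by rewrite fineK// (fin_num_measure mu_nu).
  have mS (s : R) : measurable [set z : R * R | x < z.1 + s * z.2].
    apply: measurable_set_lt => //; apply: measurable_funD => //.
    exact: measurable_funM.
  rewrite !tail_part (fin_mu_nu _ (mS 1)) (fin_mu_nu _ (mS (-1))) /=.
  have -> : [set z : R * R | x < z.1 + 1 * z.2] = [set z | x < z.1 + z.2].
    by apply/seteqP; split => z /=; rewrite mul1r.
  have -> : [set z : R * R | x < z.1 + -1 * z.2] = [set z | x < z.1 - z.2].
    by apply/seteqP; split => z /=; rewrite mulN1r.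
  by [].
have pphi' : p * fine (mgf mu gam) < 1 by rewrite -phiE.
have main := stationary_tail_equiv p0 p1 gam0 muS pphi' nu_ge0 tail_stat.
pose a1 := fine (P [set t | X t + W t + E t <= 0]).
pose a2 := fine (P [set t | X t - W t + E t <= 0]).
(* The common factor [p] settles [p = 0] at once; for [p > 0] the moment is finite and the
   extended-real equation can be read in [R]. *)
have mgf_nu : p * fine (mgf nu gam) =
    p * (p * (phi * fine (mgf nu gam) + a1) + (1 - p) * (phi * e + a2)).
  have [->|pn0] := eqVneq p 0; first by rewrite !mul0r.
  have {}pn0 : 0 < p by rewrite lt_neqAle eq_sym pn0.
  have nufin := stationary_mgf_lty p0 p1 gam0 muS pphi' nu_ge0 tail_stat pn0.
  have fin_mgf (m : probability R R) : (mgf m gam < +oo)%E -> mgf m gam \is a fin_num.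
    by rewrite ge0_fin_numE// integral_ge0// => x _; rewrite lee_fin expR_ge0.
  have mk : measurable_fun setT (fun w : R => (expR (gam * w))%:E).
    by apply/measurable_EFinP; apply: measurableT_comp => //; exact: measurable_funM.
  have k0 (w : R) : (0 <= (expR (gam * w))%:E)%E by rewrite lee_fin expR_ge0.
  have := stationary_integral indep PY1 PYN1 stat mk k0.
  rewrite (affine_pos_mgf gam0 indep Eexp 1) (affine_pos_mgf gam0 indep Eexp (-1)).
  rewrite e_fin.
  rewrite (_ : (\int[nu]_w (expR (gam * (1 * w)))%:E)%E = mgf nu gam); last first.
    by apply: eq_integral => w _; rewrite mul1r.
  rewrite (_ : [set t | 1 * W t + X t + E t <= 0] = [set t | X t + W t + E t <= 0]);
    last by apply/seteqP; split => t /=; rewrite mul1r [W t + X t]addrC.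
  rewrite (_ : [set t | -1 * W t + X t + E t <= 0] = [set t | X t - W t + E t <= 0]);
    last by apply/seteqP; split => t /=; rewrite mulN1r [- W t + X t]addrC.
  have mE (s : R) : measurable [set t | X t + s * W t + E t <= 0].
    apply: measurable_set_le => //; apply: measurable_funD => //.
    by apply: measurable_funD => //; exact: measurable_funM.
  have a1E : P [set t | X t + W t + E t <= 0] = a1%:E.
    rewrite fineK// fin_num_measure//; move: (mE 1).
    by under eq_set do rewrite mul1r.
  have a2E : P [set t | X t - W t + E t <= 0] = a2%:E.
    rewrite fineK// fin_num_measure//; move: (mE (-1)).
    by under eq_set do rewrite mulN1r.
  rewrite a1E a2E -[mgf mu gam]fineK ?fin_mgf//; last by case: muS.
  have nufin' := fineK (fin_mgf _ nufin).
  move=> mgfE.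
  congr (p * _); suff: (fine (mgf nu gam))%:E = (p * (phi * fine (mgf nu gam) + a1) +
    (1 - p) * (phi * e + a2))%:E by case.
  by apply: (etrans nufin'); apply: (etrans mgfE); rewrite -phiE -nufin'.
have pphi0 : 1 - p * phi != 0 by rewrite subr_eq0 eq_sym lt_eqF.
have CE : C = (p * fine (mgf nu gam) + (1 - p) * e) / (1 - p * phi).
  rewrite /C -/a1 -/a2 eE; move: mgf_nu; set M := fine (mgf nu gam) => ME.
  (* The moment equation is linear in [p * M] with coefficient [1 - p * phi]. Afterwards [p * (1 -
     p) * phi * e / (1 - p * phi) + (1 - p) * e] collapses to [(1 - p) * e / (1 - p * phi)], which
     yields the last term of [C]. *)
  have -> : p * M = p * (p * a1 + (1 - p) * (phi * e + a2)) / (1 - p * phi).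
    apply: (mulIf pphi0); rewrite mulfVK// mulrBr mulr1 {1}ME; ring.
  by field; rewrite pphi0 subr_eq0 eq_sym lt_eqF.
have tailE (Z : {RV P >-> R}) :
    (fun x => fine (P [set t | x < Z t])) = tail (distribution P Z).
  apply/funext => x; congr (fine (P _)); apply/seteqP.
  by split => t /=; rewrite in_itv/= andbT.
rewrite tailE (_ : (fun x => C * _) = (fun x => C * tail mu x)).
  by rewrite CE phiE.
by rewrite -[tail mu]tailE.
Qed.
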